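(* As $m\to\infty$, $s_{QN}(m,2,2)=O(\sqrt{m})$ and $s_{QN}(m,2,3)=O(m^{1/3})$.
   Context: Static set membership in the quantum bit-probe model. The universe is $[m]$. A scheme of length $s$ for sets of size at most $n$ consists of a storage map assigning to every $S\subseteq[m]$ with $|S|\le n$ a bit string $b=b(S)\in\{0,1\}^s$, and, for every $x\in[m]$, a quantum query algorithm that accesses $b$ only through the oracle $\mathcal{O}_b:\ket{i}\mapsto(-1)^{b_i}\ket{i}$ ($i\in[s]$) and outputs with probability $1$ (zero error) the bit $1$ iff $x\in S$. The scheme is non-adaptive with $t$ probes if the algorithm makes at most $t$ oracle queries, all in parallel (the queries do not depend on the answers to one another). $s_{QN}(m,n,t)$ denotes the minimum length $s$ of such a non-adaptive $t$-query scheme. *)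

(* Defs.v *)
From HB Require Import structures.
From mathcomp Require Import all_boot all_order all_algebra.
From mathcomp Require Import all_classical all_reals all_analysis.
From mathcomp Require Import complex ring.
From mathcomp Require mxtens.

Set Implicit Arguments.
Unset Strict Implicit.
Unset Printing Implicit Defensive.

Import Order.TTheory GRing.Theory Num.Theory.
Import numFieldNormedType.Exports.

Local Open Scope classical_set_scope.
Local Open Scope ring_scope.
Local Open Scope complex_scope.

Section QuantumBitProbe.
Variable R : realType.

(* |i> |-> (-1)^(b_i) |i> on C^s. *)
Definition oracle (s : nat) (b : s.-tuple bool) : 'M[R[i]]_s :=
  diag_mx (\row_i (-1) ^+ tnth b i).

(* q parallel uses of the oracle on (C^s)^{(x) q} (x) C^w, where the second
   factor is a workspace not touched by the oracle. *)
Definition parallel_oracle (s q w : nat) (b : s.-tuple bool) :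
    'M[R[i]]_(s ^ q * w) :=
  mxtens.tensmx (mxtens.ntensmx (oracle b) q) 1%:M.

(* An algorithm starts in a basis state, applies a unitary, makes at most t
   oracle queries in parallel, applies a second unitary, and measures in the
   computational basis; it outputs 1 iff the outcome lies in na_accept. The
   number of queries actually made and the size of the workspace are part of
   the algorithm. *)
Record nonadaptive_alg (s t : nat) := NonadaptiveAlg {
  na_queries : nat;
  na_work : nat;
  na_init : 'I_(s ^ na_queries * na_work);
  na_pre : 'M[R[i]]_(s ^ na_queries * na_work);
  na_post : 'M[R[i]]_(s ^ na_queries * na_work);
  na_accept : {set 'I_(s ^ na_queries * na_work)};
  na_queries_le : (na_queries <= t)%N;
  na_pre_unitary : na_pre \is unitarymx;
  na_post_unitary : na_post \is unitarymx
}.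

Definition final_state (s t : nat) (A : nonadaptive_alg s t)
    (b : s.-tuple bool) : 'cV[R[i]]_(s ^ na_queries A * na_work A) :=
  na_post A *m (parallel_oracle (na_queries A) (na_work A) b *m
    (na_pre A *m delta_mx (na_init A) 0)).

Definition output_prob (s t : nat) (A : nonadaptive_alg s t)
    (b : s.-tuple bool) (o : bool) : R[i] :=
  \sum_(k | (k \in na_accept A) == o) `|final_state A b k 0| ^+ 2.

(* The storage map is only constrained on sets with at most n elements. *)
Definition QN_scheme (m n t s : nat) : Prop :=
  exists (store : {set 'I_m} -> s.-tuple bool)
         (alg : 'I_m -> nonadaptive_alg s t),
    forall S : {set 'I_m}, (#|S| <= n)%N ->
      forall x : 'I_m, output_prob (alg x) (store S) (x \in S) = 1.

Definition is_min_length (m n t s : nat) : Prop :=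
  QN_scheme m n t s /\
  forall s' : nat, QN_scheme m n t s' -> (s <= s')%N.

(* The default value 0 is only used when no scheme exists, which never happens
   for t > 0: see sQN_min below. *)
Definition sQN (m n t : nat) : nat := xget 0%N [set s | is_min_length m n t s].

Section TwoLevel.
Variables (N : nat) (i j : 'I_N).
Hypothesis ij : i != j.
Let c : R[i] := (sqrtC 2)^-1.

Let cc : c * c = 2^-1.
Proof. by rewrite -invfM -expr2 sqrtCK. Qed.

Definition two_level_corr : 'M[R[i]]_N :=
  (c - 1) *: delta_mx i i + c *: delta_mx i j + c *: delta_mx j i
  + (- c - 1) *: delta_mx j j.

Definition two_level : 'M[R[i]]_N := 1%:M + two_level_corr.

Let ji : (j == i) = false.
Proof. by rewrite eq_sym (negbTE ij). Qed.

Lemma two_level_i :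
  two_level *m delta_mx i 0 = c *: (delta_mx i 0 + delta_mx j 0) :> 'cV_N.
Proof.
rewrite /two_level /two_level_corr !mulmxDl mul1mx -!scalemxAl.
rewrite !mul_delta_mx_cond !eqxx ji !mulr0n !mulr1n.
by apply/matrixP => a b; rewrite !mxE; ring.
Qed.

Lemma two_level_j :
  two_level *m delta_mx j 0 = c *: (delta_mx i 0 - delta_mx j 0) :> 'cV_N.
Proof.
rewrite /two_level /two_level_corr !mulmxDl mul1mx -!scalemxAl.
rewrite !mul_delta_mx_cond !eqxx (negbTE ij) !mulr0n !mulr1n.
by apply/matrixP => a b; rewrite !mxE; ring.
Qed.

Lemma two_level_unitary : two_level \is unitarymx.
Proof.
apply/unitarymxP.
have cR : Num.conj c = c.
  by apply: conj_Creal; rewrite rpredV ger0_real // sqrtC_ge0 ler0n.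
have -> : map_mx Num.conj two_level^T = two_level.
  apply/matrixP => a b; rewrite !mxE !rmorphD !rmorphM !rmorphB rmorphN.
  rewrite !rmorph1 /= !cR !conjC_nat (eq_sym b a) !(andbC (b == _)); ring.
have c2 : 2 * (c * c) = 1 by rewrite cc divff // pnatr_eq0.
suff E : two_level_corr *m two_level_corr = (-2) *: two_level_corr.
  rewrite /two_level mulmxDl mul1mx mulmxDr mulmx1 E.
  by apply/matrixP => a b; rewrite !mxE; ring.
rewrite /two_level_corr !(mulmxDl, mulmxDr) -!(scalemxAl, scalemxAr).
rewrite !mul_delta_mx_cond !eqxx ji (negbTE ij) !mulr0n !mulr1n.
by apply/matrixP => a b; rewrite !mxE; ring: c2.
Qed.

Lemma two_level_final (d : 'rV[R[i]]_N) (o : bool) :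
  d 0 i = 1 -> d 0 j = (-1) ^+ o ->
  two_level *m (diag_mx d *m (two_level *m delta_mx i 0)) =
  delta_mx (if o then j else i) 0 :> 'cV_N.
Proof.
move=> di dj.
have D k : diag_mx d *m delta_mx k 0 = d 0 k *: delta_mx k 0 :> 'cV_N.
  apply/matrixP => a b; rewrite mul_diag_mx !mxE.
  by case: (eqVneq a k) => [->|_] //=; rewrite !mulr0.
have c2 : 2 * (c * c) = 1 by rewrite cc divff // pnatr_eq0.
rewrite two_level_i -!scalemxAr mulmxDr !D di dj scale1r mulmxDr -scalemxAr.
rewrite two_level_i two_level_j.
by apply/matrixP => a b; case: o {dj}; rewrite !mxE ?expr0 ?expr1; ring: c2.
Qed.
End TwoLevel.

Lemma parallel_oracle11 (s : nat) (b : s.-tuple bool) :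
  parallel_oracle 1 1 b =
  diag_mx (\row_k (-1) ^+ tnth b (mxtens.mxtens_unindex k).1).
Proof.
apply/matrixP => k l; rewrite /parallel_oracle mxtens.ntensmx1 !mxE.
rewrite [(mxtens.mxtens_unindex k).2]ord1 [(mxtens.mxtens_unindex l).2]ord1.
rewrite eqxx mulr1.
have -> // : ((mxtens.mxtens_unindex k).1 == (mxtens.mxtens_unindex l).1)
             = (k == l).
apply/eqP/eqP => [E|-> //].
apply: (can_inj (@mxtens.mxtens_unindexK _ _)).
rewrite [LHS]surjective_pairing [RHS]surjective_pairing E.
by congr (_, _); rewrite !ord1.
Qed.

Lemma QN_scheme_exists (m n t : nat) : (0 < t)%N -> QN_scheme m n t m.+1.
Proof.
move=> t0.
pose ix (k : 'I_m.+1) : 'I_(m.+1 ^ 1 * 1) := mxtens.mxtens_index (k, ord0).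
have ixK k : (mxtens.mxtens_unindex (ix k)).1 = k by rewrite mxtens.mxtens_indexK.
have ij x : ix ord0 != ix (lift ord0 x).
  by apply/eqP => /(congr1 (fun k => (mxtens.mxtens_unindex k).1)); rewrite !ixK.
exists (fun S : {set 'I_m} =>
  [tuple if unlift ord0 k is Some x then x \in S else false | k < m.+1]).
exists (fun x => @NonadaptiveAlg m.+1 t 1 1 (ix ord0) _ _ [set~ ix ord0] t0
  (two_level_unitary (ij x)) (two_level_unitary (ij x))).
move=> S _ x; rewrite /output_prob /final_state /= parallel_oracle11.
rewrite (two_level_final (ij x) (o := x \in S)); first last.
- by rewrite !mxE ixK tnth_mktuple liftK.
- by rewrite !mxE ixK tnth_mktuple unlift_none expr0.
rewrite (bigD1 (if x \in S then ix (lift ord0 x) else ix ord0)) /=; last first.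
  by rewrite !inE; case: (x \in S); rewrite ?eqxx // eq_sym ij.
rewrite big1 ?addr0; first by rewrite mxE !eqxx normr1 expr1n.
by move=> k /andP[_ /negbTE kN]; rewrite mxE kN normr0 expr0n.
Qed.

Lemma sQN_min (m n t : nat) : (0 < t)%N -> is_min_length m n t (sQN m n t).
Proof.
move=> t0; rewrite /sQN; case: xgetP => [s _ //|none].
have ex : exists s, `[< QN_scheme m n t s >].
  by exists m.+1; apply/asboolP; exact: QN_scheme_exists.
case: (ex_minnP ex) => s /asboolP sP smin; case: (none s).
by split=> // s' /asboolP; exact: smin.
Qed.

End QuantumBitProbe.

(* Main.v *)
(** One query returns the parity of two bits, so [t] parallel queries decide the
    conjunction of [t] such parities. Give the elements of the universe distinct
    coordinates in [k^t], where [k^t >= m], and store two bit tables [A_i],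
    [C_i] of length [k] per coordinate, hence [2 t k = O(m^(1/t))] bits. Then [x]
    is accepted iff [A_i[x_i] <> C_(i+1)[x_(i+1)]] for every [i], indices being
    cyclic. If [S = {y, z}] and [y], [z] differ in every coordinate, take for
    [A_i] and [C_i] the indicators of [y_i] and [z_i]: as [A_i] and [C_i] are
    disjoint, [A_i[x_i] = 1] forces [C_i[x_i] = 0] and so
    [A_(i-1)[x_(i-1)] = 1], and going around the cycle gives [x = y]; otherwise
    every [A_i[x_i]] is [0], every [C_i[x_i]] is [1], and [x = z]. If at most one
    coordinate differs, [S] is a product set and the [C_i] can be empty. *)

Require Import Defs.
From mathcomp Require Import all_boot all_order all_algebra.
From mathcomp Require Import all_classical all_reals all_analysis.
From mathcomp Require Import complex lra.
From mathcomp Require mxtens.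
Import Order.TTheory GRing.Theory Num.Theory.
Import numFieldNormedType.Exports.
Local Open Scope classical_set_scope.
Local Open Scope ring_scope.
Local Open Scope complex_scope.

Lemma forallb_ord_recl (n : nat) (P : pred 'I_n.+1) :
  [forall j, P j] = P ord0 && [forall j : 'I_n, P (lift ord0 j)].
Proof.
apply/forallP/andP => [H|[P0 /forallP PS] j]; first by split=> //; apply/forallP.
by case: (unliftP ord0 j) => [i|] ->.
Qed.

Lemma forallb_ord0 (P : pred 'I_0) : [forall j, P j].
Proof. by apply/forallP; case. Qed.

(** * Cyclic parity tests recognising two points *)

Section CyclicTables.
Variable K : eqType.
Implicit Types y z x : K.

Local Ltac split_eqs :=
  repeat match goal with |- context [@eq_op K ?u ?v] => case: (@eq_op K u v) end.

Lemma cyclic_tables2 y0 y1 z0 z1 :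
  exists A0 A1 C0 C1 : K -> bool, forall x0 x1,
    (A0 x0 != C1 x1) && (A1 x1 != C0 x0) =
    (x0 == y0) && (x1 == y1) || (x0 == z0) && (x1 == z1).
Proof.
case: (eqVneq y0 z0) => [<-|n0]; [|case: (eqVneq y1 z1) => [<-|n1]].
- exists (pred1 y0), (pred2 y1 z1), xpred0, xpred0 => x0 x1 /=.
  by split_eqs.
- exists (pred2 y0 z0), (pred1 y1), xpred0, xpred0 => x0 x1 /=.
  by split_eqs.
exists (pred1 y0), (pred1 y1), (pred1 z0), (pred1 z1) => x0 x1 /=.
by case: (eqVneq x0 y0) => [->|_]; case: (eqVneq x1 y1) => [->|_];
  rewrite ?eqxx ?(negbTE n0) ?(negbTE n1) //=; split_eqs.
Qed.

(* When exactly two coordinates of [y] and [z] differ, their common value at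
   the remaining one has to be tested by both of the parities it enters. *)
Lemma cyclic_tables3 y0 y1 y2 z0 z1 z2 :
  exists A0 A1 A2 C0 C1 C2 : K -> bool, forall x0 x1 x2,
    [&& A0 x0 != C1 x1, A1 x1 != C2 x2 & A2 x2 != C0 x0] =
    [&& x0 == y0, x1 == y1 & x2 == y2] || [&& x0 == z0, x1 == z1 & x2 == z2].
Proof.
case: (eqVneq y0 z0) => [<-|n0]; case: (eqVneq y1 z1) => [<-|n1];
  case: (eqVneq y2 z2) => [<-|n2].
- exists (pred1 y0), (pred1 y1), (pred1 y2), xpred0, xpred0, xpred0.
  by move=> x0 x1 x2 /=; split_eqs.
- exists (pred1 y0), (pred1 y1), (pred2 y2 z2), xpred0, xpred0, xpred0.
  by move=> x0 x1 x2 /=; split_eqs.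
- exists (pred1 y0), (pred2 y1 z1), (pred1 y2), xpred0, xpred0, xpred0.
  by move=> x0 x1 x2 /=; split_eqs.
(* If [x0 = y0], the first and last parities force [x1] into {y1, z1} and [x2] into {y2, z2}, and
   the middle one matches the two choices. Otherwise they exclude all these values, and the middle
   parity is 0. The other two cases of this kind are cyclic rotations of this one. *)
- exists (predC1 y0), (pred1 y1), (pred2 y2 z2),
    (predC1 y0), (pred2 y1 z1), (pred1 z2) => x0 x1 x2 /=.
  by case: (eqVneq x1 y1) => [->|_]; case: (eqVneq x2 y2) => [->|_];
    rewrite ?eqxx ?(negbTE n1) ?(negbTE n2) //=; split_eqs.
- exists (pred2 y0 z0), (pred1 y1), (pred1 y2), xpred0, xpred0, xpred0.
  by move=> x0 x1 x2 /=; split_eqs.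
- exists (pred2 y0 z0), (predC1 y1), (pred1 y2),
    (pred1 z0), (predC1 y1), (pred2 y2 z2) => x0 x1 x2 /=.
  by case: (eqVneq x0 y0) => [->|_]; case: (eqVneq x2 y2) => [->|_];
    rewrite ?eqxx ?(negbTE n0) ?(negbTE n2) //=; split_eqs.
- exists (pred1 y0), (pred2 y1 z1), (predC1 y2),
    (pred2 y0 z0), (pred1 z1), (predC1 y2) => x0 x1 x2 /=.
  by case: (eqVneq x0 y0) => [->|_]; case: (eqVneq x1 y1) => [->|_];
    rewrite ?eqxx ?(negbTE n0) ?(negbTE n1) //=; split_eqs.
exists (pred1 y0), (pred1 y1), (pred1 y2), (pred1 z0), (pred1 z1), (pred1 z2).
move=> x0 x1 x2 /=.
by case: (eqVneq x0 y0) => [->|_]; case: (eqVneq x1 y1) => [->|_];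
  case: (eqVneq x2 y2) => [->|_];
  rewrite ?eqxx ?(negbTE n0) ?(negbTE n1) ?(negbTE n2) //=; split_eqs.
Qed.

(** The points [y] and [z] may coincide, which covers singletons. *)
Definition has_cyclic_tables (t : nat) : Prop :=
  forall y z : 'I_t -> K, exists A C : 'I_t -> K -> bool,
  forall x : 'I_t -> K,
    [forall j, A j (x j) != C (ordS j) (x (ordS j))] =
    [forall j, x j == y j] || [forall j, x j == z j].

Lemma has_cyclic_tables2 : has_cyclic_tables 2.
Proof.
move=> y z.
have [A0 [A1 [C0 [C1 H]]]] :=
  cyclic_tables2 (y ord0) (y (lift ord0 ord0)) (z ord0) (z (lift ord0 ord0)).
exists (fun i => nth A0 [:: A0; A1] i), (fun i => nth C0 [:: C0; C1] i) => x.
rewrite !forallb_ord_recl !forallb_ord0 !andbT.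
have -> : ordS ord0 = lift ord0 ord0 :> 'I_2 by exact: val_inj.
have -> : ordS (lift ord0 ord0) = ord0 :> 'I_2 by exact: val_inj.
exact: H.
Qed.

Lemma has_cyclic_tables3 : has_cyclic_tables 3.
Proof.
move=> y z; pose o1 : 'I_3 := lift ord0 ord0.
pose o2 : 'I_3 := lift ord0 (lift ord0 ord0).
have [A0 [A1 [A2 [C0 [C1 [C2 H]]]]]] :=
  cyclic_tables3 (y ord0) (y o1) (y o2) (z ord0) (z o1) (z o2).
exists (fun i => nth A0 [:: A0; A1; A2] i),
  (fun i => nth C0 [:: C0; C1; C2] i) => x.
rewrite !forallb_ord_recl !forallb_ord0 !andbT -/o1 -/o2.
have -> : ordS ord0 = o1 by exact: val_inj.
have -> : ordS o1 = o2 by exact: val_inj.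
have -> : ordS o2 = ord0 by exact: val_inj.
exact: H.
Qed.

End CyclicTables.

(** * Parallel quantum evaluation of a conjunction of parities *)

Section ParityTests.
Variable R : realType.

(* A global phase [ph] is harmless, since only moduli are measured. *)
Definition decides {B : Type} {N : nat} (U : B -> 'M[R[i]]_N) (P : B -> bool) :=
  exists V : 'M[R[i]]_N, exists init acc : 'I_N, V \is unitarymx /\
  forall b, exists k : 'I_N, exists ph : R[i],
    [/\ `|ph| = 1, V *m (U b *m (V *m delta_mx init 0)) = ph *: delta_mx k 0 :> 'cV_N
      & (k == acc) = P b].

Lemma tensmx_unitary m n (A : 'M[R[i]]_m) (B : 'M[R[i]]_n) :
  A \is unitarymx -> B \is unitarymx -> mxtens.tensmx A B \is unitarymx.
Proof.
move=> /unitarymxP HA /unitarymxP HB; apply/unitarymxP.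
rewrite mxtens.trmx_tens mxtens.map_mxT mxtens.tensmx_mul HA HB.
apply/matrixP => k l; case: (mxtens.mxtens_indexP k) => i j.
case: (mxtens.mxtens_indexP l) => i' j'.
rewrite mxtens.tensmxE !mxE -natrM mulnb.
by rewrite (can_eq (@mxtens.mxtens_indexK _ _)) xpair_eqE.
Qed.

(* [tensmx] retyped along the conversion [1 * 1 = 1] of column dimensions. *)
Definition tenscV {m n} (u : 'cV[R[i]]_m) (v : 'cV[R[i]]_n) : 'cV[R[i]]_(m * n) :=
  mxtens.tensmx u v.

Lemma tenscV_delta m n (i : 'I_m) (j : 'I_n) :
  tenscV (delta_mx i 0) (delta_mx j 0) = delta_mx (mxtens.mxtens_index (i, j)) 0.
Proof.
apply/matrixP => k l; case: (mxtens.mxtens_indexP k) => i' j'.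
rewrite !mxE mxtens.mxtens_indexK /= !ord1 !eqxx !andbT -natrM mulnb.
by rewrite (can_eq (@mxtens.mxtens_indexK _ _)) xpair_eqE.
Qed.

Lemma mul_tenscV m n (A : 'M[R[i]]_m) (B : 'M[R[i]]_n) u v :
  mxtens.tensmx A B *m tenscV u v = tenscV (A *m u) (B *m v).
Proof. exact: (@mxtens.tensmx_mul _ m m n n 1 1 A B u v). Qed.

Lemma tenscVZ m n (a b : R[i]) (u : 'cV[R[i]]_m) (v : 'cV[R[i]]_n) :
  tenscV (a *: u) (b *: v) = (a * b) *: tenscV u v.
Proof. by apply/matrixP => k l; rewrite !mxE mulrACA. Qed.

(** Basis states tensor to a basis state and phases multiply. As each factor has a single accepting
    index, the pair of these is reached iff both factors accept. *)
Lemma decides_tens {B : Type} {M N : nat} {U : B -> 'M[R[i]]_M} {U' : B -> 'M[R[i]]_N}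
    {P P' : B -> bool} :
  decides U P -> decides U' P' ->
  decides (fun b => mxtens.tensmx (U b) (U' b)) (fun b => P b && P' b).
Proof.
move=> [V [i0 [acc [VU H]]]] [V' [i0' [acc' [VU' H']]]].
exists (mxtens.tensmx V V'), (mxtens.mxtens_index (i0, i0')).
exists (mxtens.mxtens_index (acc, acc')); split; first exact: tensmx_unitary.
move=> b; have [k [ph [nph E kP]]] := H b; have [k' [ph' [nph' E' kP']]] := H' b.
exists (mxtens.mxtens_index (k, k')), (ph * ph'); split.
- by rewrite normrM nph nph' mulr1.
- by rewrite -!tenscV_delta !mul_tenscV E E' tenscVZ.
- by rewrite (can_eq (@mxtens.mxtens_indexK _ _)) xpair_eqE kP kP'.
Qed.

Lemma decides_workspace (B : Type) :
  decides (fun _ : B => 1%:M : 'M[R[i]]_1) xpredT.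
Proof.
exists 1%:M, 0, 0; split; first by apply/unitarymxP; rewrite trmx1 map_mx1 mulmx1.
by move=> _; exists 0, 1; rewrite normr1 !mul1mx scale1r.
Qed.

Lemma decides_parity {s : nat} {a c : 'I_s} : a != c ->
  decides (@oracle R s) (fun b => tnth b a != tnth b c).
Proof.
move=> ac; exists (two_level R a c), a, c; split; first exact: two_level_unitary.
move=> b; pose o := tnth b a != tnth b c; pose g : R[i] := (-1) ^+ tnth b a.
have gg : g * g = 1 by rewrite -expr2 sqrr_sign.
exists (if o then c else a), g; split; first by rewrite normrX normrN1 expr1n.
(* Multiplying the oracle by the sign [g] makes its entry at [a] equal to 1 and its entry at [c] the
   sign of the parity, as [two_level_final] requires; [g] returns as the global phase. *)
- pose d : 'rV[R[i]]_s := \row_i (g * (-1) ^+ tnth b i).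
  have dc : d 0 c = (-1) ^+ o.
    by rewrite mxE -signr_addb /o; congr (_ ^+ _); case: (tnth b a); case: (tnth b c).
  have da : d 0 a = 1 by rewrite mxE.
  rewrite -(two_level_final ac da dc).
  rewrite scalemxAr scalemxAl; congr (_ *m (_ *m _)).
  apply/matrixP => k l; rewrite !mxE; case: (k == l); last by rewrite !mulr0n mulr0.
  by rewrite !mulr1n mulrA gg mul1r.
- by rewrite -/o; case: (o); rewrite ?eqxx ?(negbTE ac).
Qed.

(** Positions are indexed by [nat] so that the induction hypothesis applies to the families shifted
    by one. *)
Lemma decides_parities (s t : nat) (a c : nat -> 'I_s) : (forall j, a j != c j) ->
  decides (fun b => mxtens.ntensmx (@oracle R s b) t.+1)
    (fun b => [forall j : 'I_t.+1, tnth b (a j) != tnth b (c j)]).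
Proof.
elim: t a c => [|t IH] a c ac.
  have [V [i0 [acc [VU H]]]] := decides_parity (ac 0%N).
  exists V, i0, acc; split=> // b; have [k [ph [nph E kP]]] := H b.
  by exists k, ph; split=> //; rewrite kP forallb_ord_recl forallb_ord0 andbT.
have [V [i0 [acc [VU H]]]] :=
  decides_tens (decides_parity (ac 0%N)) (IH (a \o S) (c \o S) (fun j => ac j.+1)).
exists V, i0, acc; split=> // b; have [k [ph [nph E kP]]] := H b.
by exists k, ph; split=> //; rewrite kP [RHS]forallb_ord_recl.
Qed.

(** * From parity tests to zero-error schemes *)

Lemma output_prob_basis (s t : nat) (A : nonadaptive_alg R s t) (b : s.-tuple bool)
    k (ph : R[i]) (o : bool) :
  `|ph| = 1 -> final_state A b = ph *: delta_mx k 0 -> (k \in na_accept A) = o ->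
  output_prob A b o = 1.
Proof.
move=> nph E ko; rewrite /output_prob E (bigD1 k) ?ko //=.
rewrite big1 ?addr0 => [|l /andP[_ /negbTE lk]].
  by rewrite !mxE !eqxx mulr1 nph expr1n.
by rewrite !mxE lk mulr0 normr0 expr0n.
Qed.

Lemma QN_scheme_parities (m n t : nat) (T : finType)
    (store : {set 'I_m} -> T -> bool) (a c : 'I_m -> 'I_t.+1 -> T) :
  (forall x j, a x j != c x j) ->
  (forall S : {set 'I_m}, (#|S| <= n)%N -> forall x,
    [forall j, store S (a x j) != store S (c x j)] = (x \in S)) ->
  QN_scheme R m n t.+1 #|T|.
Proof.
move=> ac storeP.
exists (fun S => [tuple store S (enum_val k) | k < #|T|]).
suff alg x : exists A : nonadaptive_alg R #|T| t.+1, forall S : {set 'I_m}, (#|S| <= n)%N ->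
    output_prob A [tuple store S (enum_val k) | k < #|T|] (x \in S) = 1.
  have [A HA] := choice alg; exists A => S Sn x; exact: HA.
pose r (f : 'I_m -> 'I_t.+1 -> T) (j : nat) : 'I_#|T| := enum_rank (f x (inord j)).
have rac j : r a j != r c j by rewrite (inj_eq enum_rank_inj).
have [V [i0 [acc [VU H]]]] :=
  decides_tens (decides_parities _ t (r a) (r c) rac) (decides_workspace _).
pose A := @NonadaptiveAlg R #|T| t.+1 t.+1 1 i0 V V [set acc]%SET (leqnn _) VU VU.
exists A.
move=> S Sn; have [k [ph [nph E kP]]] := H [tuple store S (enum_val k) | k < #|T|].
apply: (@output_prob_basis _ _ A _ k ph) => //=.
rewrite inE kP andbT -storeP //; apply: eq_forallb => j.
by rewrite !tnth_mktuple !enum_rankK inord_val.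
Qed.

Lemma set_le2 (T : finType) (S : {set T}) : (#|S| <= 2)%N ->
  S = finset.set0 \/ exists y z, S = [set y; z]%SET.
Proof.
case: (posnP #|S|) => [/eqP|]; first by rewrite cards_eq0 => /eqP; left.
move=> S0; rewrite leq_eqVlt orbC ltnS => /orP[S1|/cards2P[y [z [_ ->]]]]; right.
  have /cards1P[y ->] : #|S| == 1%N by rewrite eqn_leq S1.
  by exists y, y; rewrite finset.setUid.
by exists y, z.
Qed.

Lemma QN_scheme_cyclic (m k t : nat) :
  (1 < t)%N -> has_cyclic_tables 'I_k t -> (m <= k ^ t)%N ->
  QN_scheme R m 2 t (2 * t * k).
Proof.
case: t => // t t1 tab mkt.
have [coord coord_inj] : exists f : 'I_m -> {ffun 'I_t.+1 -> 'I_k}, injective f.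
  have E : (k ^ t.+1 = #|{ffun 'I_t.+1 -> 'I_k}|)%N by rewrite card_ffun !card_ord.
  exists (fun x => enum_val (cast_ord E (widen_ord mkt x))).
  by move=> x y /enum_val_inj/cast_ord_inj/(congr1 val)/= /val_inj.
have coordE x y : [forall j, coord x j == coord y j] = (x == y).
  apply/forallP/eqP => [H|-> //]; apply/coord_inj/ffunP => j; exact/eqP.
(* The flag separates the tables [A] ([false]) from [C] ([true]), so the two bits of a parity always
   have distinct addresses. *)
pose T := (bool * 'I_t.+1 * 'I_k)%type.
have store (S : {set 'I_m}) : exists f : T -> bool, (#|S| <= 2)%N -> forall x,
    [forall j, f (false, j, coord x j) != f (true, ordS j, coord x (ordS j))]
    = (x \in S).
  (* For sets that are too large [xpred0] is a mere default; for the empty set it makes every parity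
     0, so all elements are rejected. *)
  case: (leqP #|S| 2) => [/set_le2[->|[y [z ->]]]|_]; last by exists xpred0.
    exists xpred0 => _ x; rewrite finset.in_set0; apply/negbTE/forallPn.
    by exists (Ordinal (ltnW t1)).
  have [A [C AC]] := tab (coord y) (coord z).
  exists (fun u => if u.1.1 then C u.1.2 u.2 else A u.1.2 u.2) => _ x /=.
  by rewrite AC !coordE !inE.
have [f fP] := choice store.
have -> : (2 * t.+1 * k = #|{: T}|)%N by rewrite !card_prod card_bool !card_ord.
apply: (@QN_scheme_parities m 2 t T f (fun x j => (false, j, coord x j))
  (fun x j => (true, ordS j, coord x (ordS j)))) => // S S2 x; exact: fP.
Qed.

(** * Asymptotic length *)

Lemma sQN_bigO (t : nat) : (1 < t)%N -> (forall k, has_cyclic_tables 'I_k t) ->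
  (fun m : nat => (sQN R m 2 t)%:R : R) =O_\oo
  (fun m : nat => m%:R `^ t%:R^-1 : R).
Proof.
(* The length is [2 * t * k], and [k <= r + 1 <= 2 * r] once [m >= 1]. *)
move=> t1 tab; apply/eqO_exP; exists (4 * t)%:R.
  by rewrite ltr0n muln_gt0 /= (ltnW t1).
near=> m.
have m1 : 1 <= m%:R :> R by rewrite ler1n; near: m; exists 1%N.
pose r : R := m%:R `^ t%:R^-1; rewrite -/r.
have r1 : 1 <= r by rewrite -(powRr0 (m%:R)) ler_powR // invr_ge0.
(* The successor ensures [r < k], hence [m <= k ^ t]. *)
pose k := (Num.truncn r).+1.
have /andP[kle kgt] := truncn_itv (le_trans ler01 r1).
have mk : (m <= k ^ t)%N.
  rewrite -(ler_nat R) natrX.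
  have -> : m%:R = r ^+ t.
    rewrite -powR_mulrn ?powR_ge0 // -powRrM mulVf ?powRr1 //.
    by rewrite pnatr_eq0 -lt0n (ltnW t1).
  by rewrite lerXn2r ?nnegrE ?(le_trans ler01 r1) // ltW.
have [_ smin] := sQN_min R m 2 (ltnW t1).
have := smin _ (@QN_scheme_cyclic m k t t1 (tab k) mk).
rewrite -(ler_nat R) normr_nat => /le_trans; apply.
rewrite (ger0_norm (le_trans ler01 r1)) !natrM.
have kr : k%:R <= 2 * r by rewrite /k -natr1; lra.
have t0 : 0 <= t%:R :> R by [].
nra.
Unshelve. all: by end_near.
Qed.

End ParityTests.

Theorem theorem3 (R : realType) :
  ((fun m : nat => (sQN R m 2 2)%:R : R) =O_\oo
     (fun m : nat => Num.sqrt m%:R : R)) /\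
  ((fun m : nat => (sQN R m 2 3)%:R : R) =O_\oo
     (fun m : nat => m%:R `^ 3^-1 : R)).
Proof.
split; last exact: sQN_bigO (fun k => has_cyclic_tables3 'I_k).
have -> : (fun m : nat => Num.sqrt m%:R : R) = (fun m => m%:R `^ 2^-1).
  by apply/funext => m; rewrite powR12_sqrt.
exact: sQN_bigO (fun k => has_cyclic_tables2 'I_k).
Qed.
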